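(* Let $(\xi_n)_{n\in\mathbb{N}}\subset L^0_+$ be a sequence of nonnegative random variables on a probability space $(\Omega,\mathscr{F},\mathbb{P})$, let $(\xi_{n_k})_{k\in\mathbb{N}}$ be a subsequence and let $\xi:\Omega\to[0,\infty]$ be a nonnegative random variable such that (a) $(\xi_{n_k})_{k\in\mathbb{N}}$ is $\mathbb{P}$-almost surely Cesàro convergent to $\xi$; and (b) there exists an equivalent probability measure $\mathbb{Q}\approx\mathbb{P}$ such that the sequence $(\xi_{n_k}\mathbf{1}_{\{\xi<\infty\}})_{k\in\mathbb{N}}$ is $L^1(\mathbb{Q})$-bounded. Let $\bar\xi_{n_k}:=\frac1k\sum_{l=1}^k\xi_{n_l}$ for $k\in\mathbb{N}$. Let $(\zeta_k)_{k\in\mathbb{N}}$ denote either one of the two sequences $(\xi_{n_k})_{k\in\mathbb{N}}$ and $(\bar\xi_{n_k})_{k\in\mathbb{N}}$. Then: (1) The set $\{\xi<\infty\}$ is the largest set $B\in\mathscr{F}$ such that $\{X\mathbf{1}_B: X\in\mathrm{conv}\{\zeta_k:k\in\mathbb{N}\}\}$ is bounded in probability. (2) The set $\{\xi<\infty\}$ is the largest set $B\in\mathscr{F}$ such that $(\zeta_k\mathbf{1}_B)_{k\in\mathbb{N}}$ is $L^1(\mathbb{Q})$-bounded for some equivalent probability measure $\mathbb{Q}\approx\mathbb{P}$. (3) The set $\{\xi<\infty\}$ is the largest set $B\in\mathscr{F}$ such that for every sequence $(\eta_n)_{n\in\mathbb{N}}\subset\mathrm{conv}\{\zeta_k:k\in\mathbb{N}\}$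 the sequence $(\eta_n\mathbf{1}_B)_{n\in\mathbb{N}}$ has a subsequence whose distributions under $\mathbb{P}$ converge weakly. Here ''the largest set $B\in\mathscr{F}$ with a property'' means that the set has the property and contains, up to a $\mathbb{P}$-null set, every set $B\in\mathscr{F}$ with that property.
   Context: $L^0=L^0(\Omega,\mathscr{F},\mathbb{P})$ is the space of equivalence classes (modulo $\mathbb{P}$-almost sure equality) of real-valued random variables, and $L^0_+$ is the convex cone of all $X\in L^0$ with $\mathbb{P}(X\ge 0)=1$. A sequence $(X_k)_{k\in\mathbb{N}}\subset L^0_+$ is $\mathbb{P}$-almost surely Cesàro convergent to $X:\Omega\to[0,\infty]$ if $\frac1k\sum_{l=1}^k X_l\to X$ $\mathbb{P}$-almost surely in $[0,\infty]$. For a probability measure $\mathbb{Q}$ equivalent to $\mathbb{P}$ (written $\mathbb{Q}\approx\mathbb{P}$; same null sets), a set $K\subset L^0$ is $L^1(\mathbb{Q})$-bounded if $\sup_{X\in K}\mathbb{E}_{\mathbb{Q}}[|X|]<\infty$; a sequence is $L^1(\mathbb{Q})$-bounded if the set of its members is. A set $K\subset L^0$ is bounded in probability if for every $\epsilon>0$ there is $M>0$ with $\sup_{X\in K}\mathbb{P}(|X|>M)<\epsilon$. $\mathrm{conv}$ denotes the convex hull (finite convex combinations). Weak convergence of distributions means weak convergence to a probability measure on $(\mathbb{R},\mathscr{B}(\mathbb{R}))$. *)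

(* Defs.v *)
(* MathComp / MathComp-Analysis *)
From HB Require Import structures.
From mathcomp Require Export all_boot all_order all_algebra.
From mathcomp Require Export all_classical all_reals all_analysis.
From mathcomp Require Export measurable_realfun.

Set Implicit Arguments.
Unset Strict Implicit.
Unset Printing Implicit Defensive.

Import Order.TTheory GRing.Theory Num.Theory.
Import numFieldNormedType.Exports.

Local Open Scope classical_set_scope.
Local Open Scope ring_scope.

(* Elements of L^0 are represented by measurable functions T -> R; all the
   properties below are invariant under almost sure equality. *)

Definition convex_hull (R : numDomainType) (E : lmodType R) (A : set E) :
    set E :=
  [set x | exists (n : nat) (a : 'I_n -> R) (v : 'I_n -> E),
     [/\ forall i, 0 <= a i, \sum_i a i = 1, forall i, A (v i) &
         x = \sum_i a i *: v i]].

Section L0.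
Context d (T : measurableType d) (R : realType).
Implicit Types (P Q : probability T R) (K : set {mfun T >-> R}).

Definition equivalent_prob P Q : Prop := P `<< Q /\ Q `<< P.

Definition L1_bounded Q K : Prop :=
  (ereal_sup [set 'E_Q[fun w => `|X w|%R] | X in K] < +oo)%E.

Definition bounded_in_probability P K : Prop :=
  forall eps : R, 0 < eps -> exists2 M : R, 0 < M &
    (ereal_sup [set P [set w | (M < `|X w|)%R] | X in K] < eps%:E)%E.

(* X 1_B *)
Definition cut (X : {mfun T >-> R}) (B : set T) (mB : measurable B) :
    {mfun T >-> R} := X * indic_mfun B mB.

(* Indices start at 0: this is (X_0 + ... + X_k) / (k + 1). *)
Definition cesaro (X : nat -> {mfun T >-> R}) (k : nat) : {mfun T >-> R} :=
  (k.+1%:R : R)^-1 *: \sum_(l < k.+1) X l.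

(* A has the property and contains, up to a P-null set, every measurable set
   that has it. *)
Definition is_largest P (prop : forall B : set T, measurable B -> Prop)
    (A : set T) (mA : measurable A) : Prop :=
  prop A mA /\
  forall (B : set T) (mB : measurable B), prop B mB -> P (B `\` A) = 0%E.

Lemma measurable_lt_pinfty (f : T -> \bar R) :
  measurable_fun [set: T] f -> measurable [set w | (f w < +oo)%E].
Proof.
by move=> mf; rewrite -[X in measurable X]setTI; apply: measurable_lte.
Qed.

End L0.

Section weak_convergence.
Context (R : realType).

Definition weak_cvg (mu : nat -> probability R R) (nu : probability R R) :
    Prop :=
  forall f : R -> R, continuous f -> bounded_fun f ->
    (\int[mu n]_x (f x)%:E)%E @[n --> \oo] --> (\int[nu]_x (f x)%:E)%E.

Definition has_weakly_cvg_subseq (mu : nat -> probability R R) : Prop :=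
  exists phi : nat -> nat, {homo phi : i j / (i < j)%N} /\
    exists nu : probability R R, weak_cvg (mu \o phi) nu.

End weak_convergence.

(* Main.v *)
(* Write S_k for the Cesaro means of (xi_{n_k}); in both cases they lie in
   conv{zeta_k}, converge a.s. to xi, and E_Q|S_k 1_{xi < oo}| is bounded by the
   bound in (b), as is E_Q|X 1_{xi < oo}| for every X in conv{zeta_k}.

   - L^1(Q)-boundedness on B passes to the convex hull by the triangle
     inequality, and gives boundedness in probability by Markov's inequality
     and absolute continuity of P with respect to Q.
   - Boundedness in probability is tightness of the distributions, hence gives
     weakly convergent subsequences (Prokhorov's theorem on the line).
   - If the distributions of a subsequence of (S_k 1_B) are eventually tight,
     as they are under any of the three properties, then S_k -> oo a.s. on
     B \ {xi < oo} forces this set to be null.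

   Prokhorov's theorem is obtained from quantile functions: tightness bounds
   them pointwise on ]0, 1[, a diagonal subsequence converges at all rationals,
   hence by monotonicity at all but countably many points, and the limit law is
   the image of Lebesgue measure on ]0, 1[ under the limit. *)

Require Import Defs.
From HB Require Import structures.

Set Implicit Arguments.
Unset Strict Implicit.
Unset Printing Implicit Defensive.

Import Order.TTheory GRing.Theory Num.Theory.
Import numFieldNormedType.Exports.

Local Open Scope classical_set_scope.
Local Open Scope ring_scope.

(** * Prokhorov's theorem on the real line *)

Lemma leq_homo_ltn (phi : nat -> nat) :
  {homo phi : i j / (i < j)%N} -> forall n, (n <= phi n)%N.
Proof.
by move=> phi_incr; elim=> // n /leq_ltn_trans; apply; exact: phi_incr.
Qed.

(** Cantor's diagonal argument: Bolzano-Weierstrass refines the current subsequence once per row,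
    and from some rank on the diagonal runs inside each refinement. *)
Lemma diagonal_subseq (R : realType) (x : nat -> nat -> R) :
  (forall j, bounded_fun (x j)) ->
  exists2 phi : nat -> nat, {homo phi : i j / (i < j)%N} &
    forall j, cvgn (x j \o phi).
Proof.
move=> xb.
have /choice[f fP] (jpsi : nat * (nat -> nat)) : exists f : nat -> nat,
    {homo f : i j / (i < j)%N} /\ cvgn (x jpsi.1 \o jpsi.2 \o f).
  have [|f /increasing_seqP fi fc] :=
      @bolzano_weierstrass R (x jpsi.1 \o jpsi.2).
    have [M [Mr MP]] := xb jpsi.1; exists M; split => // r Mr' n _ /=.
    exact: (MP r).
  by exists f; split => //; apply: (homo_ltn ltn_trans) => n; exact: fi.
(* Along [Psi j] the rows of index below [j] converge; row [j] is settled by passing to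
   [Psi j.+1]. *)
pose fix Psi j := if j is j'.+1 then Psi j' \o f (j', Psi j') else id.
have ge_f p := leq_homo_ltn (fP p).1.
have Psi_homo j : {homo Psi j : i k / (i < k)%N}.
  by elim: j => //= j IH i k ik; apply: IH; exact: (fP _).1.
(* The [m]-th term of a later refinement occurs in the earlier one at rank at least [m], so limits
   along [Psi j.+1] carry over to the diagonal. *)
have PsiD i k m : exists2 m', (m <= m')%N & Psi (k + i)%N m = Psi i m'.
  elim: k m => [|k IH] m; first by exists m.
  have [m' mm' E] := IH (f ((k + i)%N, Psi (k + i)%N) m).
  by exists m' => //; rewrite (leq_trans _ mm').
exists (fun n => Psi n n).
  apply: (homo_ltn ltn_trans) => n /=; apply: Psi_homo.
  exact: (leq_trans (ltnSn n) (ge_f _ _)).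
move=> j; have /cvg_ex[L xL] := (fP (j, Psi j)).2.
apply/cvg_ex; exists L; apply/cvgrPdist_lt => e e0.
have /cvgrPdist_lt/(_ _ e0)[N _ NP] := xL.
exists (maxn N j.+1) => // n /=; rewrite geq_max => /andP[Nn jn].
have [m nm] := PsiD j.+1 (n - j.+1)%N n; rewrite subnK // => ->.
by apply: (NP m) => /=; rewrite (leq_trans Nn).
Qed.

(** * Distribution functions *)

Section distribution_function.
Context (R : realType) (mu : probability R R).

Definition dist_fun (x : R) : R := fine (mu `]-oo, x]%classic).

(** [cdf] is attached to a random variable; the identity under [mu] has law [mu], so [dist_fun]
    inherits the properties of [cdf]. *)
Let idR : R -> R := idfun.
#[local] HB.instance Definition _ :=
  @isMeasurableFun.Build _ _ _ _ idR (@measurable_id _ _ setT).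

Let dist_funE : dist_fun = fine \o cdf (P := mu) idR.
Proof. by []. Qed.

Lemma dist_fun_nondecreasing : {homo dist_fun : x y / x <= y}.
Proof.
move=> x y xy; rewrite fine_le ?fin_num_measure//.
exact: (@cdf_nondecreasing _ _ _ mu idR).
Qed.

Lemma dist_fun_ge0 x : 0 <= dist_fun x.
Proof. exact: fine_ge0. Qed.

Lemma dist_fun_le1 x : dist_fun x <= 1.
Proof. by rewrite -lee_fin fineK ?fin_num_measure// probability_le1. Qed.

Lemma cvg_dist_funy : dist_fun x @[x --> +oo] --> (1 : R).
Proof. rewrite dist_funE; exact/fine_cvg/(@cvg_cdfy1 _ _ _ mu idR). Qed.

Lemma cvg_dist_funNy : dist_fun x @[x --> -oo] --> (0 : R).
Proof. rewrite dist_funE; exact/fine_cvg/(@cvg_cdfNy0 _ _ _ mu idR). Qed.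

Lemma dist_fun_right_continuous x : dist_fun y @[y --> x^'+] --> dist_fun x.
Proof.
apply: fine_cvg; rewrite fineK ?fin_num_measure//.
exact: (@cdf_right_continuous _ _ _ mu idR).
Qed.

End distribution_function.

(** * Quantile functions and the uniform law *)

Section quantile.
Context (R : realType).
Implicit Types (mu : probability R R) (u x : R).

(* The value outside ]0, 1[ is junk; the domain is [measurableTypeR R] because
   that is the copy of [R] on which [lebesgue_measure] is defined. *)
Definition quantile mu (u : measurableTypeR R) : R :=
  if 0 < (u : R) < 1 then inf [set x : R | (u : R) <= dist_fun mu x] else 0.

(** The superlevel set is nonempty since [u < 1], bounded below since [0 < u], and contains its
    infimum by right continuity. This Galois connection turns questions on quantiles into questions
    on distribution functions. *)
Lemma quantile_le mu u x : 0 < u < 1 ->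
  (quantile mu u <= x) = (u <= dist_fun mu x).
Proof.
move=> u01; rewrite /quantile u01; case/andP: u01 => u0 u1.
set S := [set _ | _].
have S0 : S !=set0.
  have /cvgr_gt/(_ u u1)[M [_ MP]] := cvg_dist_funy mu.
  by exists (M + 1); apply/ltW/MP; rewrite ltrDl.
have Slb : has_lbound S.
  have /cvgr_lt/(_ u u0)[M [_ MP]] := cvg_dist_funNy mu.
  exists (M - 1) => s /= uFs; rewrite leNgt; apply/negP => sM.
  have /MP : s < M by rewrite (lt_trans sM)// gtrBl.
  by move=> /(le_lt_trans uFs); rewrite ltxx.
apply/idP/idP => [infx|ux]; last exact: ge_inf.
have Fx := @dist_fun_right_continuous R mu x.
rewrite -(cvg_lim _ Fx)//; apply: limr_ge.
  by apply/cvg_ex; exists (dist_fun mu x).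
(* The infimum is at most [x < y], so some point of [S] lies below [y]; then [y] decreases to
   [x]. *)
near=> y.
have [s us sy] : exists2 s, S s & s < y.
  by apply: inf_lt => //; rewrite (le_lt_trans infx).
exact: (le_trans us (dist_fun_nondecreasing mu (ltW sy))).
Unshelve. all: by end_near. Qed.

Lemma quantile_nondecreasing mu u v : 0 < u -> u <= v -> v < 1 ->
  quantile mu u <= quantile mu v.
Proof.
move=> u0 uv v1; rewrite quantile_le ?u0 ?(le_lt_trans uv)//.
by rewrite (le_trans uv)// -quantile_le ?v1 ?(lt_le_trans u0).
Qed.

Lemma quantile_preimage mu x : `]0, 1[ `&` quantile mu @^-1` `]x, +oo[ =
  `]dist_fun mu x, 1[%classic.
Proof.
apply/seteqP; split=> [u []|u] /=; rewrite !in_itv/= ?andbT.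
  by move=> u01; rewrite ltNge quantile_le// -ltNge => ->; case/andP: u01.
move=> /andP[Fu u1]; have u01 : 0 < u < 1.
  by rewrite u1 (le_lt_trans (dist_fun_ge0 _ _) Fu).
by split => //; rewrite ltNge quantile_le// -ltNge.
Qed.

Lemma measurable_quantile mu :
  measurable_fun [set: measurableTypeR R] (quantile mu).
Proof.
apply: (measurability _ (RGenOInfty.measurableE R)) => //.
move=> _ [_ [x ->] <-]; rewrite setTI.
(* Outside []0, 1[] the value is 0, which exceeds [x] exactly when [x < 0]. *)
have -> : quantile mu @^-1` `]x, +oo[ = `]dist_fun mu x, 1[ `|`
    (if x < 0 then ~` `]0, 1[ else set0).
  rewrite -quantile_preimage; set D := (X in X `&` _).
  rewrite -[LHS](setTI) -(setUv D) setIUl; congr (_ `|` _).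
  apply/seteqP; split => u /=.
    move=> [nDu]; rewrite /= in_itv/= andbT /quantile.
    by move: (nDu); rewrite /D/= in_itv/= => /negP/negbTE -> ->.
  case: ifPn => // x0 Du; split=> //; rewrite in_itv/= andbT /quantile.
  by move: Du; rewrite /= in_itv/= => /negP/negbTE ->.
by apply: measurableU => //; case: ifP => // _; apply: measurableC.
Qed.

HB.instance Definition _ mu :=
  isMeasurableFun.Build _ _ (measurableTypeR R) R (quantile mu)
    (@measurable_quantile mu).

End quantile.

Section uniform01.
Context (R : realType).

Let D : set (measurableTypeR R) := `]0, 1[%classic.
Let mD : measurable D.
Proof. exact: measurable_itv. Qed.

Definition lebesgue01 : set (measurableTypeR R) -> \bar R :=
  mrestr (@lebesgue_measure R) mD.

HB.instance Definition _ := Measure.on lebesgue01.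

Let lebesgue01_setT : lebesgue01 setT = 1%E.
Proof.
rewrite /lebesgue01/= /mrestr setTI lebesgue_measure_itv/= lte_fin ltr01.
by rewrite oppr0 adde0.
Qed.

HB.instance Definition _ :=
  Measure_isProbability.Build _ _ _ lebesgue01 lebesgue01_setT.

(** The half-lines []x, +oo[] form a pi-system generating the Borel sets, and [mu] gives them mass
    [1 - dist_fun mu x], the length of []dist_fun mu x, 1[]. *)
Lemma pushforward_quantile (mu : probability R R) A : measurable A ->
  distribution lebesgue01 (quantile mu) A = mu A.
Proof.
move=> mA; apply: (measure_unique (@RGenOInfty.G R)
  (fun n => `]- n%:R, +oo[%classic)) => //.
- exact: RGenOInfty.measurableE.
- move=> _ _ [x ->] [y ->]; exists (Num.max x y).
  by apply/seteqP; split=> z /=; rewrite !in_itv/= !andbT gt_max => /andP.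
- by move=> n; exists (- n%:R).
- rewrite -subTset => x _; exists (Num.truncn `|x|).+1 => //=.
  rewrite in_itv/= andbT ltrNl (le_lt_trans (ler_norm _))// normrN.
  exact: truncnS_gt.
- move=> _ [x ->].
  rewrite /distribution /pushforward/= /lebesgue01 /mrestr setIC.
  rewrite quantile_preimage lebesgue_measure_itv/= lte_fin.
  have -> : `]x, +oo[%classic = ~` `]-oo, x]%classic by rewrite setCitvl.
  rewrite probability_setC// -[mu _]fineK ?fin_num_measure//.
  rewrite -/(dist_fun mu x); case: ltP => // F1.
  (* Here [dist_fun mu x] is 1: the interval is empty and both sides vanish. *)
  by rewrite (@le_anti _ _ (dist_fun mu x) 1) ?F1 ?dist_fun_le1// subee.
- by move=> n; rewrite ltey_eq fin_num_measure.
Qed.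

End uniform01.

(** * Compactness of quantile functions *)

Lemma measurable_norm_gt (R : realType) (M : R) :
  measurable [set x : R | M < `|x|].
Proof.
rewrite (_ : [set x | _] = setT `&` (@Num.norm _ R) @^-1` `]M, +oo[).
  by apply: (normr_measurable (D := setT)).
by rewrite setTI; apply/seteqP; split=> x /=; rewrite in_itv/= andbT.
Qed.

(** The lower limit [l] and upper limit [h] of a bounded divergent sequence differ, and two
    rationals fit strictly between them. Rational levels leave only countably many pairs. *)
Lemma not_cvg_oscillates (R : realType) (x : nat -> R) :
  bounded_fun x -> ~ cvgn x ->
  exists cc : rat * rat, [/\ ratr cc.1 < ratr cc.2 :> R,
    forall N, exists2 n, (N <= n)%N & x n < ratr cc.1 &
    forall N, exists2 n, (N <= n)%N & ratr cc.2 < x n].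
Proof.
move=> bx ncx.
have ux : has_ubound (range x) := bounded_fun_has_ubound bx.
have lx : has_lbound (range x) := bounded_fun_has_lbound bx.
have uxN N : has_ubound (sdrop x N).
  by case: ux => M MP; exists M => _ [n _ <-]; apply: MP; exists n.
have lxN N : has_lbound (sdrop x N).
  by case: lx => M MP; exists M => _ [n _ <-]; apply: MP; exists n.
have xN0 N : sdrop x N !=set0 by exists (x N), N => /=.
have infx := cvg_infs_sup ux lx; have supx := cvg_sups_inf ux lx.
set l := sup _ in infx; set h := inf _ in supx.
have infxsup n : infs x n <= x n <= sups x n.
  apply/andP; split; [apply: ge_inf => //|apply: ub_le_sup => //];
    by exists n => /=.
have lh : l <= h.
  apply: ler_cvg_to infx supx _; apply: nearW => n.
  by case/andP: (infxsup n) => /le_trans; apply.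
(* Equality would squeeze [x] between [infs x] and [sups x] and make it converge. *)
have {lh} lh : l < h.
  rewrite lt_neqAle lh andbT; apply/eqP => eq_lh; apply: ncx; apply/cvg_ex.
  by exists l; apply: squeeze_cvgr infx _; [exact: nearW|rewrite eq_lh].
have [c'] := rat_in_itvoo lh; rewrite in_itv/= => /andP[lc' c'h].
have [c] := rat_in_itvoo lc'; rewrite in_itv/= => /andP[lc cc'].
exists (c, c'); split=> //= N.
- have [|_ [n /= Nn <-] xc] := @inf_lt _ (sdrop x N) (ratr c) (xN0 N);
    last by exists n.
  apply: le_lt_trans lc; apply: ub_le_sup; last by exists N.
  case: ux => M MP; exists M => _ [n _ <-].
  by case/andP: (infxsup n) => /le_trans + _; apply; apply: MP; exists n.
- have [|_ [n /= Nn <-] xc] := @sup_gt _ (sdrop x N) (ratr c') (xN0 N);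
    last by exists n.
  apply: lt_le_trans c'h _; apply: ge_inf; last by exists N.
  case: lx => M MP; exists M => _ [n _ <-].
  by case/andP: (infxsup n) => _; apply: le_trans; apply: MP; exists n.
Qed.

(* Each bad point is sent to a pair of rationals between which Q n u oscillates.
   This is injective: for bad points u < v and a rational r in between, the
   limit of Q n r is at least the upper rational of u and at most the lower
   rational of v. *)
Lemma monotone_cvg_but_countable (R : realType) (Q : nat -> R -> R) (a b : R) :
  (forall n u v, a < u -> u <= v -> v < b -> Q n u <= Q n v) ->
  (forall u, a < u < b -> bounded_fun (Q ^~ u)) ->
  (forall r : rat, a < ratr r < b -> cvgn (Q ^~ (ratr r))) ->
  countable [set u | a < u < b /\ ~ cvgn (Q ^~ u)].
Proof.
move=> ndQ bQ cQ.
have /choice[f fP] (u : R) : exists cc : rat * rat,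
    a < u < b -> ~ cvgn (Q ^~ u) ->
    [/\ ratr cc.1 < ratr cc.2 :> R,
    forall N, exists2 n, (N <= n)%N & Q n u < ratr cc.1 &
    forall N, exists2 n, (N <= n)%N & ratr cc.2 < Q n u].
  have [uab|] := boolP (a < u < b); last by exists (0, 0).
  have [|ncu] := pselect (cvgn (Q ^~ u)); first by exists (0, 0).
  by have [cc ?] := not_cvg_oscillates (bQ _ uab) ncu; exists cc.
apply/countable_injP; exists (pickle \o f).
suff lt_inj u v : u < v -> a < u < b -> a < v < b -> ~ cvgn (Q ^~ u) ->
    ~ cvgn (Q ^~ v) -> f u <> f v.
  move=> u v /set_mem[uab cu] /set_mem[vab cv] /(pcan_inj pickleK) fuv.
  by have [uv|vu|//] := ltgtP u v; [case: (lt_inj u v)|case: (lt_inj v u)].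
move=> uv uab vab cu cv fuv.
have [cc' _ Qu] := fP u uab cu; have [_ Qv _] := fP v vab cv.
have [r] := rat_in_itvoo uv; rewrite in_itv/= => /andP[ur rv].
have rab : a < ratr r < b.
  move: uab vab => /andP[au _] /andP[_ vb].
  by rewrite (lt_trans au ur) (lt_trans rv vb).
have /cvg_ex[L QL] := cQ r rab.
have [Lc|cL] := ltP L (ratr (f u).2).
  have [N _ NP] := cvgr_lt _ QL _ Lc; have [n Nn] := Qu N.
  apply/negP; rewrite -leNgt (le_trans _ (ltW (NP n Nn)))//.
  by apply: ndQ; [case/andP: uab|exact: ltW|case/andP: rab].
have [N _ NP] := cvgr_gt _ QL _ (lt_le_trans cc' cL); have [n Nn] := Qv N.
rewrite -fuv; apply/negP; rewrite -leNgt (le_trans (ltW (NP n Nn)))//.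
by apply: ndQ; [case/andP: rab|exact: ltW|case/andP: vab].
Qed.

(** When the mass outside [[-K, K]] is smaller than both [u] and [1 - u], the quantile at [u] lies
    in [[-K, K]]. *)
Lemma bounded_quantiles (R : realType) (mu : nat -> probability R R) (u : R) :
  (forall eps : R, 0 < eps ->
    exists M : R, forall n, (mu n [set x | (M < `|x|)%R] <= eps%:E)%E) ->
  bounded_fun (fun n => quantile (mu n) u).
Proof.
move=> tight_mu; have [u01|nu] := boolP (0 < u < 1); last first.
  exists 0; split=> // x /ltW x0 n _ /=.
  by rewrite /quantile (negbTE nu) normr0.
have /andP[u0 u1] := u01.
(* Halving makes the tail strictly smaller than [u], which rules out a quantile below [- K]. *)
have e0 : 0 < Num.min u (1 - u) / 2.
  by rewrite divr_gt0// lt_min u0 subr_gt0.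
have [M MP] := tight_mu _ e0.
exists (Num.max 0 M + 1); split; first by rewrite num_real.
move=> K MK n _ /=.
have M1 : M < Num.max 0 M + 1 by rewrite ltr_pwDr// le_max lexx orbT.
have MK' : M < K := lt_trans M1 MK.
have le_tail (A : set R) : measurable A -> A `<=` [set x : R | M < `|x|] ->
    (mu n A <= (Num.min u (1 - u) / 2)%:E)%E.
  move=> mA AM; apply: le_trans (MP n); apply: le_measure; rewrite ?inE//.
  exact: measurable_norm_gt.
rewrite ler_norml; apply/andP; split.
  rewrite leNgt; apply/negP => /ltW; rewrite quantile_le// => uF.
  have := le_tail `]-oo, (- K)]%classic (measurable_itv _) _.
  rewrite -[mu n _]fineK ?fin_num_measure// lee_fin => /(_ _)/(le_trans uF).
  move=> H; have : u <= Num.min u (1 - u) / 2.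
    apply: H => x /=; rewrite in_itv/= lerNr => Kx.
    by rewrite (lt_le_trans MK')// (le_trans Kx)// -normrN ler_norm.
  apply/negP; rewrite -ltNge ltr_pdivrMr//.
  rewrite (le_lt_trans (y := u)) ?ge_min ?lexx//.
  by rewrite mulr2n mulrDr mulr1 ltrDl.
rewrite quantile_le// -lee_fin /dist_fun fineK ?fin_num_measure//.
have -> : `]-oo, K]%classic = ~` `]K, +oo[%classic by rewrite setCitvr.
rewrite probability_setC// leeBrDr ?fin_num_measure// addeC -leeBrDr//.
apply: le_trans (le_tail `]K, +oo[%classic (measurable_itv _) _) _.
  move=> x /=; rewrite in_itv/= andbT => Kx.
  by rewrite (lt_le_trans (lt_trans MK' Kx))// ler_norm.
rewrite lee_fin ler_pdivrMr// (le_trans (y := 1 - u)) ?ge_min ?lexx ?orbT//.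
by rewrite mulr2n mulrDr mulr1 lerDl subr_ge0 ltW.
Qed.

Lemma integral_quantile (R : realType) (mu : probability R R) (f : R -> R) :
  measurable_fun setT f -> bounded_fun f ->
  (\int[mu]_x (f x)%:E = \int[@lebesgue01 R]_u (f (quantile mu u))%:E)%E.
Proof.
move=> mf bf.
rewrite -(@eq_measure_integral _ _ _ _ mu
  (distribution (@lebesgue01 R) (quantile mu))); last first.
  by move=> A mA _; exact: pushforward_quantile.
rewrite integral_distribution//; first exact/measurable_EFinP.
apply: measurable_bounded_integrable => //.
- by rewrite ltey_eq fin_num_measure.
- exact: measurableT_comp.
- by case: bf => M [Mr MP]; exists M; split => // x Mx u _; exact: (MP x).
Qed.

(** Skorokhod's representation: quantile functions realize all the laws on []0, 1[], where almost
    everywhere convergence and dominated convergence give the limits of the integrals. *)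
Theorem tight_weakly_cvg_subseq (R : realType) (mu : nat -> probability R R) :
  (forall eps : R, 0 < eps ->
    exists M : R, forall n, (mu n [set x | (M < `|x|)%R] <= eps%:E)%E) ->
  has_weakly_cvg_subseq mu.
Proof.
move=> tight_mu; have bq := bounded_quantiles _ tight_mu.
(* Row [j] holds the quantiles at the rational coded by [j], or zeros if [j] codes none. *)
pose x j n : R := oapp (fun r : rat => quantile (mu n) (ratr r)) 0 (unpickle j).
have [j|phi phi_incr phiP] := @diagonal_subseq R x.
  rewrite /x; case: unpickle => [r|]/=; first exact: bq.
  by exists 0; split=> // y /ltW y0 n _ /=; rewrite normr0.
exists phi; split => //.
pose Q n u := quantile (mu (phi n)) u.
have bQ u : bounded_fun (Q ^~ u).
  by case: (bq u) => M [Mr MP]; exists M; split => // y My n _; exact: (MP y).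
have cQ (r : rat) : cvgn (Q ^~ (ratr r)).
  by have := phiP (pickle r); rewrite /x pickleK.
(* The upper limit is defined at every point, is measurable, and equals the limit wherever one
   exists. *)
pose q : measurableTypeR R -> R := fun u => limn_sup (Q ^~ u).
have mq : measurable_fun setT q.
  apply: measurable_fun_limn_sup => [u _|u _|n].
  - exact: bounded_fun_has_ubound.
  - exact: bounded_fun_has_lbound.
  - exact: measurable_quantile.
pose qm : {mfun measurableTypeR R >-> R} :=
  HB.pack q (isMeasurableFun.Build _ _ _ _ q mq).
exists (distribution (@lebesgue01 R) qm) => f cf bf.
have mf := continuous_measurable_fun cf.
have [C Cf] : exists C : R, forall y, `|f y| <= C.
  by case: bf => M [Mr MP]; exists (M + 1) => y; apply: MP => //; rewrite ltrDl.
have bounded_f (g : measurableTypeR R -> R) : [bounded f (g u) | u in setT].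
  by case: bf => M [Mr MP]; exists M; split => // y My u _; exact: (MP y).
rewrite integral_distribution//; [|exact/measurable_EFinP|]; last first.
  apply: measurable_bounded_integrable => //.
  - by rewrite ltey_eq fin_num_measure.
  - exact: measurableT_comp.
have -> : (fun n => \int[(mu \o phi) n]_x0 (f x0)%:E)%E =
    (fun n => \int[@lebesgue01 R]_u (f (Q n u))%:E)%E.
  by apply/funext => n /=; rewrite integral_quantile.
have [] // := @dominated_convergence _ _ _ (@lebesgue01 R) setT measurableT
  (fun n u => (f (Q n u))%:E) (fun u => (f (q u))%:E) (cst C%:E).
- move=> n; apply/measurable_EFinP; apply: measurableT_comp => //.
- by apply/measurable_EFinP; apply: measurableT_comp.
(* Only points of []0, 1[] can be exceptional: elsewhere every quantile is 0. *)
- pose S := [set u : R | 0 < u < 1 /\ ~ cvgn (Q ^~ u)].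
  have cS : countable S.
    apply: monotone_cvg_but_countable => //.
    by move=> n u v; exact: quantile_nondecreasing.
  have mS : @measurable _ (measurableTypeR R) S.
    by apply: countable_measurable => // t; exact: measurable_set1.
  exists S; split => //.
    apply/eqP; rewrite eq_le measure_ge0 andbT.
    rewrite -(countable_lebesgue_measure0 cS).
    by rewrite /= /lebesgue01 /mrestr measureIl//; exact: measurable_itv.
  move=> u /=; apply: contra_notP => /not_andP nSu _.
  have {nSu} cu : cvgn (Q ^~ u).
    case: nSu => [/negP nu|/contrapT//].
    suff -> : Q ^~ u = cst 0 by apply/cvg_ex; exists 0; exact: cvg_cst.
    by apply/funext => n; rewrite /Q /quantile (negbTE nu).
  have fQ : f (Q n u) @[n --> \oo] --> f (q u).
    rewrite /q (cvg_limn_supE cu); apply: continuous_cvg => //; exact: cf.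
  by apply: cvg_EFin fQ; exact: nearW.
- exact: finite_measure_integrable_cst.
- by apply: aeW => u n _; rewrite lee_fin.
Qed.

(** * Convex hulls, tails and null sets *)

Section convex_hull_L0.
Context d (T : measurableType d) (R : realType).
Implicit Types (P Q : probability T R) (X : {mfun T >-> R}).

Lemma mfun_sumE n (F : 'I_n -> {mfun T >-> R}) w :
  (\sum_i F i) w = \sum_i F i w.
Proof.
by rewrite (big_morph (fun X : {mfun T >-> R} => X w) (id1 := 0) (op1 := +%R)).
Qed.

Lemma sub_convex_hull (A : set {mfun T >-> R}) : A `<=` convex_hull A.
Proof.
move=> X AX; exists 1%N, (fun=> 1), (fun=> X); split=> //.
  by rewrite big_ord1.
by rewrite big_ord1 scale1r.
Qed.

Lemma cesaro_convex_hull (X : nat -> {mfun T >-> R}) k :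
  convex_hull (range X) (cesaro X k).
Proof.
exists k.+1, (fun=> k.+1%:R^-1), X; split=> //.
- by rewrite sumr_const card_ord -[LHS]mulr_natl divff.
- by rewrite /cesaro scaler_sumr.
Qed.

Lemma L1_boundedP Q (K : set {mfun T >-> R}) : L1_bounded Q K ->
  exists C : R, forall X, K X -> (\int[Q]_w `|X w|%:E <= C%:E)%E.
Proof.
rewrite /L1_bounded; have : ubound [set 'E_Q[fun w => `|X w|%R] | X in K]%E
    (ereal_sup [set 'E_Q[fun w => `|X w|%R] | X in K]%E) :=
    @ereal_sup_ubound _ _.
(* If the supremum is [-oo], the real bound 0 will do. *)
case: ereal_sup => [r||]// ubK _; [exists r|exists 0] => X KX.
  by have := ubK _ (ex_intro2 _ _ X KX erefl); rewrite unlock.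
have := ubK _ (ex_intro2 _ _ X KX erefl); rewrite unlock => /le_trans; apply.
exact: leNye.
Qed.

Lemma cutE X B (mB : measurable B) w : cut X mB w = X w * \1_B w.
Proof. by []. Qed.

Lemma convex_hull_L1_le Q (z : nat -> {mfun T >-> R}) B (mB : measurable B)
    (C : \bar R) X :
  (forall k, (\int[Q]_w `|cut (z k) mB w|%:E <= C)%E) ->
  convex_hull (range z) X -> (\int[Q]_w `|cut X mB w|%:E <= C)%E.
Proof.
move=> zC [n [a [v [a0 a1 zv ->]]]].
have mabs (Y : {mfun T >-> R}) :
    measurable_fun setT (fun w => `|Y w|%:E : \bar R).
  by apply/measurable_EFinP; apply: measurableT_comp.
have mcabs (c : R) (Y : {mfun T >-> R}) :
    measurable_fun setT (fun w => (c * `|Y w|)%:E).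
  by under eq_fun do rewrite EFinM; exact: measurable_funeM (mabs Y).
apply: (@le_trans _ _ (\int[Q]_w \sum_i (a i * `|cut (v i) mB w|)%:E)%E).
  apply: ge0_le_integral => //.
  - apply: emeasurable_sum => i; exact: mcabs.
  - move=> w _; rewrite sumEFin lee_fin.
    rewrite !cutE (mfun_sumE (fun i => a i *: v i)) mulr_suml.
    rewrite (le_trans (ler_norm_sum _ _ _))//.
    by apply: ler_sum => i _; rewrite cutE -mulrA normrM ger0_norm.
rewrite ge0_integral_sum//; last by move=> i w _; rewrite lee_fin mulr_ge0.
apply: (@le_trans _ _ (\sum_i ((a i)%:E * C))%E).
  apply: lee_sum => i _; under eq_integral do rewrite EFinM.
  rewrite ge0_integralZl//; last by rewrite lee_fin.
  by apply: lee_wpmul2l; [rewrite lee_fin|have [k _ <-] := zv i; exact: zC].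
rewrite -ge0_sume_distrl; first by rewrite sumEFin a1 mul1e.
by move=> i _; rewrite lee_fin.
Qed.

(** The epsilon-delta form of absolute continuity is known for the total variation of a charge; [P],
    seen as a charge, is dominated by its variation. *)
Lemma prob_abs_continuous P Q : P `<< Q -> forall eps : R, 0 < eps ->
  exists2 dlt : R, 0 < dlt &
    forall A, measurable A -> (Q A < dlt%:E -> P A < eps%:E)%E.
Proof.
move=> PQ eps eps0.
pose nu := charge_of_finite_measure P.
have [Pos [Neg nuPN]] := Hahn_decomposition nu.
have nuQ : nu `<< Q by [].
have [dlt [dlt0 dltP]] := charge_variation_continuous nuPN nuQ eps0.
exists dlt => // A mA QA; apply: le_lt_trans (dltP A mA QA).
by apply: le_trans (abse_charge_variation nuPN mA); rewrite gee0_abs.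
Qed.

End convex_hull_L0.

(** * Markov's inequality and escape to infinity *)

Section tails.
Context d (T : measurableType d) (R : realType).
Implicit Types (P Q : probability T R) (X : {mfun T >-> R}).

Lemma measurable_tail X (M : R) : measurable [set w | M < `|X w|].
Proof.
exact: (measurable_funPTI X (measurable_norm_gt M)).
Qed.

(** Markov's inequality makes the tails uniformly small under [Q], and absolute continuity transfers
    this to [P]. *)
Lemma L1_bounded_in_probability P Q (K : set {mfun T >-> R}) (C : R) :
  P `<< Q -> (forall X, K X -> (\int[Q]_w `|X w|%:E <= C%:E)%E) ->
  bounded_in_probability P K.
Proof.
(* Strict bounds survive a supremum only as weak ones, so [eps / 2] is aimed at. *)
move=> PQ KC eps eps0; have eps20 : 0 < eps / 2 by rewrite divr_gt0.
have [dlt dlt0 dltP] := prob_abs_continuous PQ eps20.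
(* [C1] is positive and exceeds [C], so Markov's inequality at level [C1 / dlt] yields a probability
   strictly below [dlt]. *)
pose C1 := Num.max 0 C + 1.
have C10 : 0 < C1 by rewrite ltr_wpDl// le_max lexx.
have M0 : 0 < C1 / dlt by rewrite divr_gt0.
exists (C1 / dlt) => //.
apply: (@le_lt_trans _ _ (eps / 2)%:E); last first.
  by rewrite lte_fin ltr_pdivrMr// ltr_pMr// ltr1n.
apply: ge_ereal_sup => _ [X KX <-].
apply/ltW/dltP; first exact: measurable_tail.
rewrite -(lte_pmul2l (z := (C1 / dlt)%:E)) ?lte_fin// -EFinM divfK ?gt_eqF//.
apply: (@le_lt_trans _ _ (\int[Q]_w `|X w|%:E)%E); last first.
  apply: le_lt_trans (KC X KX) _.
  by rewrite lte_fin ltr_pwDr// le_max lexx orbT.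
have := @markov _ _ _ Q X idfun _ M0 (@measurable_id _ _ setT).
move=> /(_ (fun=> id) (fun _ _ _ _ => id)); rewrite unlock; apply: le_trans.
apply: lee_wpmul2l; first by rewrite lee_fin ltW.
apply: le_measure; rewrite ?inE; first exact: measurable_tail.
  rewrite (_ : [set w | _] = setT `&` (fun w => `|X w|) @^-1` `[C1 / dlt, +oo[).
    have mX : measurable_fun setT (fun w => `|X w|) by exact: measurableT_comp.
    exact: mX.
  by rewrite setTI; apply/seteqP; split=> w /=; rewrite in_itv/= andbT lee_fin.
by move=> w /= /ltW; rewrite lee_fin.
Qed.

Lemma bounded_in_probability_tail P (K : set {mfun T >-> R}) (eps : R) :
  bounded_in_probability P K -> 0 < eps ->
  exists M : R, forall X, K X -> (P [set w | (M < `|X w|)%R] <= eps%:E)%E.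
Proof.
move=> bK eps0; have [M M0 supK] := bK _ eps0; exists M => X KX.
by apply: le_trans (ltW supK); apply: ereal_sup_ubound; exists X.
Qed.

(** Almost every point of [B] with [xi] infinite eventually stays in the events [|Y k| > M], whose
    probabilities are eventually at most [eps]; as [eps] is arbitrary, such points form a null
    set. *)
Lemma escape_null P (Y : nat -> {mfun T >-> R}) (xi : T -> \bar R)
    (mA : measurable [set w | (xi w < +oo)%E])
    (B : set T) (mB : measurable B) :
  {ae P, forall w, (Y k w)%:E @[k --> \oo] --> xi w} ->
  (forall eps : R, 0 < eps -> exists M : R, \forall k \near \oo,
    (P [set w | (M < `|cut (Y k) mB w|)%R] <= eps%:E)%E) ->
  P (B `\` [set w | (xi w < +oo)%E]) = 0%E.
Proof.
set A := [set w | _] in mA *; move=> [N [mN PN0 YN]] tightY.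
apply/eqP; rewrite eq_le measure_ge0 andbT.
apply/lee_addgt0Pr => eps eps0; rewrite add0e.
have [M [n0 _ n0P]] := tightY _ eps0.
pose D := (B `\` A) `\` N.
have mD : measurable D by apply: measurableD => //; exact: measurableD.
pose E k := [set w | (M < `|cut (Y k) mB w|)%R].
have mE k : measurable (E k) by exact: measurable_tail.
(* [G n] collects the points that have escaped for good by time [n]. These sets increase to [D], and
   each lies in [E n]. *)
pose G n := D `&` \bigcap_(k in [set k | (n <= k)%N]) E k.
have mG n : measurable (G n).
  by apply: measurableI => //; apply: bigcap_measurable => //; exists n => /=.
have GD : \bigcup_n G n = D.
  apply/seteqP; split => w; first by case=> n _ [].
  move=> Dw; have [[Bw nAw] nNw] := Dw.
  have Yw : (Y k w)%:E @[k --> \oo] --> +oo%E.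
    have : xi w = +oo%E.
      by apply/eqP; rewrite -leye_eq leNgt; apply/negP.
    by move=> <-; apply: contrapT => ?; apply: nNw; exact: YN.
  have [n _ nP] := cvgey_gt Yw M.
  exists n => //; split=> // k /= nk.
  have := nP k nk; rewrite lte_fin => /lt_le_trans; apply.
  by rewrite cutE indicE mem_set// mulr1 ler_norm.
apply: (@le_trans _ _ (P D)).
  apply: (@le_trans _ _ (P (D `|` N))).
    apply: le_measure; rewrite ?inE; [exact: measurableD|exact: measurableU|].
    by move=> w BAw; have [Nw|nNw] := pselect (N w); [right|left].
  by rewrite -[leRHS]addr0 -PN0; exact: measureU2.
have PG : P (G n) @[n --> \oo] --> P D.
  rewrite -GD; apply: nondecreasing_cvg_mu => //; first by rewrite GD.
  move=> m n mn; apply/subsetPset => w [Dw mE']; split => // k /= nk.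
  by apply: mE' => /=; exact: leq_trans nk.
rewrite -(cvg_lim _ PG)//; apply: lime_le; first by apply/cvg_ex; exists (P D).
exists n0 => // n /= n0n; apply: le_trans (n0P n n0n).
apply: le_measure; rewrite ?inE; [exact: mG|exact: mE|].
by move=> w [_]; apply => /=.
Qed.

End tails.

(** * Tails under weak convergence *)

Section weak_convergence_tails.
Context (R : realType).

Lemma prob_tail_lt (nu : probability R R) (eps : R) : 0 < eps ->
  exists M : R, (nu [set x | (M < `|x|)%R] < eps%:E)%E.
Proof.
move=> eps0; pose F (n : nat) := [set x : R | n%:R < `|x|].
have F0 : \bigcap_n F n = set0.
  rewrite -subset0 => x /(_ (Num.truncn `|x|).+1 I).
  by rewrite /F/= ltNge ltW// truncnS_gt.
have : nu (F n) @[n --> \oo] --> nu (\bigcap_n F n).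
  apply: nonincreasing_cvg_mu => //.
  - by rewrite ltey_eq fin_num_measure//; exact: measurable_norm_gt.
  - by move=> n; exact: measurable_norm_gt.
  - by apply: bigcap_measurable => // n _; exact: measurable_norm_gt.
  - move=> n m nm; apply/subsetPset => x; rewrite /F/=; apply: le_lt_trans.
    by rewrite ler_nat.
rewrite F0 measure0 => /fine_cvg/cvgr_lt/(_ _ eps0)[n _ /(_ n (leqnn n)) /=] nP.
exists n%:R; rewrite -[nu _]fineK ?lte_fin//.
by rewrite fin_num_measure//; exact: measurable_norm_gt.
Qed.

(** Tail indicators are not continuous, so a continuous function between two of them carries the
    tail bound from [nu] to [mu n], at the price of raising [M] by 1. *)
Lemma weak_cvg_tail_le (mu : nat -> probability R R) (nu : probability R R)
    (eps : R) : weak_cvg mu nu -> 0 < eps ->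
  exists M : R, \forall n \near \oo, (mu n [set x | (M < `|x|)%R] <= eps%:E)%E.
Proof.
move=> munu eps0; have [M nuM] := prob_tail_lt nu eps0.
(* 1_{|x| > M + 1} <= f <= 1_{|x| > M} *)
pose f : R -> R := cst 1 \min (cst 0 \max (fun x => `|x| - M)).
have f0 x : 0 <= f x by rewrite /f le_min ler01 le_max lexx.
have f1 x : f x <= 1 by rewrite /f ge_min lexx.
have cf : continuous f.
  move=> x; apply: continuous_min; first exact: cvg_cst.
  apply: continuous_max; first exact: cvg_cst.
  by apply: cvgB; [exact: norm_continuous|exact: cvg_cst].
have bf : bounded_fun f.
  exists 1; split=> // y /ltW y1 x _ /=.
  by rewrite ger0_norm// (le_trans (f1 x)).
have mf : measurable_fun setT (fun x => (f x)%:E).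
  by apply/measurable_EFinP; exact: continuous_measurable_fun.
have mindic A : measurable A ->
    measurable_fun setT (fun x : R => (\1_A x)%:E : \bar R).
  by move=> mA; apply/measurable_EFinP; exact: measurable_indic.
have tailE (la : probability R R) (a : R) : la [set x | (a < `|x|)%R] =
    (\int[la]_x (\1_[set x : R | (a < `|x|)%R] x)%:E)%E.
  by rewrite integral_indic ?setIT//; exact: measurable_norm_gt.
have le_tail (la : probability R R) (a : R) :
    (forall x, f x <= \1_[set x : R | a < `|x|] x) ->
    (\int[la]_x (f x)%:E <= la [set x | (a < `|x|)%R])%E.
  move=> fa; have ma := measurable_norm_gt a.
  rewrite tailE; apply: ge0_le_integral => //.
  - by move=> x _; rewrite lee_fin.
  - exact: mindic.
  - by move=> x _; rewrite lee_fin.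
have ge_tail (la : probability R R) (a : R) :
    (forall x, \1_[set x : R | a < `|x|] x <= f x) ->
    (la [set x | (a < `|x|)%R] <= \int[la]_x (f x)%:E)%E.
  move=> fa; have ma := measurable_norm_gt a.
  rewrite tailE; apply: ge0_le_integral => //.
  - exact: mindic.
  - by move=> x _; rewrite lee_fin.
have nuf : (\int[nu]_x (f x)%:E < eps%:E)%E.
  apply: le_lt_trans nuM; apply: le_tail => x.
  rewrite indicE; case: (boolP (x \in _)) => [_|]; first exact: f1.
  rewrite notin_setE/= => /negP; rewrite -leNgt => xM.
  by rewrite /f /= ge_min ge_max lexx /= subr_le0 xM orbT.
have nuf_fin : (\int[nu]_x (f x)%:E)%E \is a fin_num.
  rewrite ge0_fin_numE; first by rewrite (lt_trans nuf)// ltry.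
  by apply: integral_ge0 => x _; rewrite lee_fin.
have := munu f cf bf.
(* The limit is finite, so the integrals are eventually finite and can be compared as reals. *)
rewrite -[X in _ --> X](fineK nuf_fin) => /fine_cvgP[muf_fin].
move=> /cvgr_lt/(_ eps); rewrite -lte_fin fineK// => /(_ nuf) muf.
exists (M + 1); near=> n; apply: (@le_trans _ _ (\int[mu n]_x (f x)%:E)%E).
  apply: ge_tail => x; rewrite indicE; case: (boolP (x \in _)) => [|_]//=.
  rewrite inE/= => Mx; rewrite /f/= le_min lexx le_max lerBrDl (ltW Mx).
  by rewrite orbT.
rewrite -[leLHS]fineK; last by near: n.
by rewrite lee_fin ltW//; near: n.
Unshelve. all: by end_near. Qed.

End weak_convergence_tails.

(** * Maximality of the set where the Cesaro limit is finite *)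

Theorem mainTheorem2 (d : measure_display) (T : measurableType d)
    (R : realType) (P : probability T R)
    (xi_ : nat -> {mfun T >-> R})
    (xi_ge0 : forall n, {ae P, forall w, 0 <= xi_ n w})
    (n_ : nat -> nat) (n_incr : {homo n_ : i j / (i < j)%N})
    (xi : T -> \bar R) (mxi : measurable_fun [set: T] xi)
    (xi_nneg : forall w, (0 <= xi w)%E)
    (xi_cesaro : {ae P, forall w,
       (cesaro (xi_ \o n_) k w)%:E @[k --> \oo] --> xi w})
    (xi_bounded : exists2 Q : probability T R, equivalent_prob Q P &
       L1_bounded Q
         (range (fun k => cut (xi_ (n_ k)) (measurable_lt_pinfty mxi))))
    (zeta : nat -> {mfun T >-> R})
    (zetaE : zeta = xi_ \o n_ \/ zeta = cesaro (xi_ \o n_)) :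
  [/\ is_largest P
        (fun B mB => bounded_in_probability P
           [set cut X mB | X in convex_hull (range zeta)])
        (measurable_lt_pinfty mxi),
      is_largest P
        (fun B mB => exists2 Q : probability T R, equivalent_prob Q P &
           L1_bounded Q (range (fun k => cut (zeta k) mB)))
        (measurable_lt_pinfty mxi) &
      is_largest P
        (fun B mB => forall eta : nat -> {mfun T >-> R},
           (forall n, convex_hull (range zeta) (eta n)) ->
           has_weakly_cvg_subseq (fun n => distribution P (cut (eta n) mB)))
        (measurable_lt_pinfty mxi)].
Proof.
set mA := measurable_lt_pinfty mxi.
set X := xi_ \o n_.
pose hull := convex_hull (range zeta).
(* For either choice of [zeta], the Cesaro means are available in the hull as the sequence that
   escapes. *)
have cesaro_hull k : hull (cesaro X k).
  rewrite /hull; case: zetaE => ->; first exact: cesaro_convex_hull.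
  by apply: sub_convex_hull; exists k.
pose L1_prop B (mB : measurable B) := exists2 Q : probability T R,
  equivalent_prob Q P & L1_bounded Q (range (fun k => cut (zeta k) mB)).
pose bip_prop B (mB : measurable B) :=
  bounded_in_probability P [set cut Y mB | Y in hull].
have L1_bip B (mB : measurable B) : L1_prop B mB -> bip_prop B mB.
  move=> [Q [QP PQ] /L1_boundedP[C zC]].
  apply: (L1_bounded_in_probability (Q := Q) (C := C)) => // _ [Y hY <-].
  by apply: convex_hull_L1_le hY => k; apply: zC; exists k.
have bip_null B (mB : measurable B) : bip_prop B mB ->
    P (B `\` [set w | (xi w < +oo)%E]) = 0%E.
  move=> bB.
  apply: (@escape_null _ _ _ P (cesaro X) xi mA _ mB) => // eps eps0.
  have [M MP] := bounded_in_probability_tail bB eps0; exists M.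
  by apply: nearW => k; apply: MP; exists (cesaro X k).
have L1_A : L1_prop _ mA.
  have [Q QP /L1_boundedP[C XC]] := xi_bounded; exists Q => //.
  have XkC k : (\int[Q]_w `|cut (X k) mA w|%:E <= C%:E)%E.
    by apply: XC; exists k.
  apply: (@le_lt_trans _ _ C%:E); last exact: ltry.
  apply: ge_ereal_sup => _ [_ [k _ <-] <-]; rewrite unlock.
  (* The bound is taken over the hull of [X], which contains both choices of [zeta]; so the measure
     [Q] of the hypothesis serves for both. *)
  apply: convex_hull_L1_le XkC _; case: zetaE => ->.
    by apply: sub_convex_hull; exists k.
  exact: cesaro_convex_hull.
split; split.
- exact: L1_bip.
- exact: bip_null.
- exact: L1_A.
- by move=> B mB /L1_bip; exact: bip_null.
- move=> eta hull_eta; apply: tight_weakly_cvg_subseq => eps eps0.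
  have [M MP] := bounded_in_probability_tail (L1_bip _ _ L1_A) eps0.
  exists M => n; apply: (MP (cut (eta n) mA)).
  by exists (eta n); first exact: hull_eta.
(* The property is tested on the Cesaro means alone; almost sure convergence persists along [phi],
   so escape to infinity is applied to that subsequence. *)
- move=> B mB /(_ _ cesaro_hull)[phi [phi_incr [nu munu]]].
  have phi_oo : phi n @[n --> \oo] --> \oo.
    move=> S [N _ NS]; exists N => // n /= Nn.
    by apply: NS => /=; exact: leq_trans Nn (leq_homo_ltn phi_incr n).
  apply: (@escape_null _ _ _ P (cesaro X \o phi) xi mA _ mB) => //.
    by move: xi_cesaro; apply: filterS => w; exact: cvg_comp phi_oo.
  move=> eps eps0; have [M MP] := weak_cvg_tail_le munu eps0.
  by exists M; exact: MP.
Qed.
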